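(* Let $\{a,b,c\}$ with $a<b<c$ be a $D(4)$-triple, and let $r=\sqrt{ab+4}$, $s=\sqrt{ac+4}$, $t=\sqrt{bc+4}$. Suppose that $r,s,t$ are the side lengths of a non-degenerate triangle. Then $$r^2+s^2-t^2=r^2-(b-a)(2r+a+b),$$ and exactly one of the following three cases holds for the triangle with side lengths $r,s,t$: (1) it is acute if and only if $r^2>(b-a)(2r+a+b)$; (2) it is right if and only if $r^2=(b-a)(2r+a+b)$; (3) it is obtuse if and only if $r^2<(b-a)(2r+a+b)$.
   Context: A $D(4)$-triple is a set of three distinct positive integers such that the product of any two distinct elements, increased by $4$, is a perfect square. The numbers $r,s,t$ are then positive integers with $r<s<t$, so they are the side lengths of a non-degenerate triangle exactly when $r+s>t$. *)

(* Defs.v *)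
From Stdlib Require Import ZArith Reals.

Definition perfect_square (n : Z) : Prop := exists k : Z, n = (k * k)%Z.

Definition D4_triple (a b c : Z) : Prop :=
  (0 < a /\ 0 < b /\ 0 < c)%Z /\
  (a <> b /\ a <> c /\ b <> c) /\
  perfect_square (a * b + 4) /\
  perfect_square (a * c + 4) /\
  perfect_square (b * c + 4).

Open Scope R_scope.

Definition point : Type := (R * R)%type.

Definition dist (P Q : point) : R := dist_euc (fst P) (snd P) (fst Q) (snd Q).

Definition collinear (A B C : point) : Prop :=
  exists u v w : R,
    (u <> 0 \/ v <> 0) /\
    u * fst A + v * snd A = w /\
    u * fst B + v * snd B = w /\
    u * fst C + v * snd C = w.

Definition triangle_with_sides (A B C : point) (x y z : R) : Prop :=
  ~ collinear A B C /\ dist A B = x /\ dist B C = y /\ dist C A = z.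

(* Unoriented angle PVQ in [0, PI]; meaningful when P <> V and Q <> V. *)
Definition angle (P V Q : point) : R :=
  acos (((fst P - fst V) * (fst Q - fst V) + (snd P - snd V) * (snd Q - snd V))
        / (dist P V * dist Q V)).

Definition acute_triangle (A B C : point) : Prop :=
  angle B A C < PI / 2 /\ angle C B A < PI / 2 /\ angle A C B < PI / 2.

Definition right_triangle (A B C : point) : Prop :=
  angle B A C = PI / 2 \/ angle C B A = PI / 2 \/ angle A C B = PI / 2.

Definition obtuse_triangle (A B C : point) : Prop :=
  angle B A C > PI / 2 \/ angle C B A > PI / 2 \/ angle A C B > PI / 2.

Definition exactly_one (P Q S : Prop) : Prop :=
  (P /\ ~ Q /\ ~ S) \/ (~ P /\ Q /\ ~ S) \/ (~ P /\ ~ Q /\ S).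

(* Main.v *)
(** The fourth element d = a + b + c + (abc - rst)/2 of the triple is a
    non-negative integer for which ad + 4, bd + 4, cd + 4 are the squares of
    x = (rs - at)/2, y = (rt - bs)/2, z = (cr - st)/2, and conversely
    s = (rx + ay)/2 and t = (ry + bx)/2.  If d = 0 then x = y = 2, so s = r + a
    and hence c = a + b + 2r.  If d > 0 then x < y and
    2(t - s) = r(y - x) + (bx - ay) with bx > ay: this is at least 2r when
    y - x >= 2, and also when y = x + 1, because then bx - ay >= r.  So r + s > t
    forces c = a + b + 2r.  The angle opposite t is the only one that can fail
    to be acute, and by the law of cosines its type is the sign of
    r^2 + s^2 - t^2 = r^2 - (b - a)c. *)

From Stdlib Require Import ZArith Reals Lia Lra.
Require Import Defs.
Open Scope R_scope.

(** * Integer arithmetic of D(4)-triples *)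

(** [m - n] and [m + n] have the same parity. This makes the halves that define [x], [y] and [d]
    below integral. *)
Lemma even_diff_of_squares (m n k : Z) :
  (m * m - n * n = 2 * k)%Z -> exists l, (m - n = 2 * l)%Z.
Proof.
  intros H.
  destruct (Z.Even_or_Odd (m - n)) as [[l Hl] | [l Hl]]; [now exists l|].
  exfalso.
  assert (Hm : m = (n + 2 * l + 1)%Z) by lia. subst m.
  assert (((n + 2 * l + 1) * (n + 2 * l + 1) - n * n
           = 2 * (2 * l * l + 2 * l + 2 * l * n + n) + 1)%Z) by ring.
  lia.
Qed.

(** A smaller maximum would make [a * b + 4] one of 6, 7, 10, none of them a square. The bound later
    turns [c * d + 4 >= 0] into [d >= 0]. *)
Lemma D4_max_ge_5 (a b c r s t : Z) :
  (0 < a)%Z -> (a < b)%Z -> (b < c)%Z ->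
  (0 < r)%Z -> (0 < s)%Z -> (0 < t)%Z ->
  (r * r = a * b + 4)%Z -> (s * s = a * c + 4)%Z -> (t * t = b * c + 4)%Z ->
  (5 <= c)%Z.
Proof.
  intros Ha Hab Hbc Hr Hs Ht Er Es Et.
  destruct (Z_lt_le_dec c 5) as [Hc|]; [exfalso|assumption].
  assert (Hcases : (a = 1 /\ b = 2 \/ a = 1 /\ b = 3 /\ c = 4
                    \/ a = 2 /\ b = 3 /\ c = 4)%Z) by lia.
  destruct Hcases as [[-> ->]|[[-> [-> ->]]|[-> [-> ->]]]].
  - assert (r <= 2 \/ 3 <= r)%Z as [|] by lia; nia.
  - assert (r <= 2 \/ 3 <= r)%Z as [|] by lia; nia.
  - assert (r <= 3 \/ 4 <= r)%Z as [|] by lia; nia.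
Qed.

Lemma D4_extension (a b c r s t : Z) :
  (0 < a)%Z -> (a < b)%Z -> (b < c)%Z ->
  (0 < r)%Z -> (0 < s)%Z -> (0 < t)%Z ->
  (r * r = a * b + 4)%Z -> (s * s = a * c + 4)%Z -> (t * t = b * c + 4)%Z ->
  exists d x y : Z,
    (0 <= d /\ 0 < x /\ 0 < y /\
     x * x = a * d + 4 /\ y * y = b * d + 4 /\
     2 * s = r * x + a * y /\ 2 * t = r * y + b * x)%Z.
Proof.
  intros Ha Hab Hbc Hr Hs Ht Er Es Et.
  pose proof (D4_max_ge_5 a b c r s t Ha Hab Hbc Hr Hs Ht Er Es Et) as Hc5.
  assert (Ers : (r * s * (r * s) = (a * b + 4) * (a * c + 4))%Z)
    by (rewrite <- Er, <- Es; ring).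
  assert (Ert : (r * t * (r * t) = (a * b + 4) * (b * c + 4))%Z)
    by (rewrite <- Er, <- Et; ring).
  assert (Est : (s * t * (s * t) = (a * c + 4) * (b * c + 4))%Z)
    by (rewrite <- Es, <- Et; ring).
  assert (Eat : (a * t * (a * t) = a * a * (b * c + 4))%Z)
    by (rewrite <- Et; ring).
  assert (Ebs : (b * s * (b * s) = b * b * (a * c + 4))%Z)
    by (rewrite <- Es; ring).
  destruct (even_diff_of_squares (r * s) (a * t)
              (2 * (a * b + a * c + 4 - a * a))) as [x Ex].
  { rewrite Ers, Eat. ring. }
  destruct (even_diff_of_squares (r * t) (b * s)
              (2 * (a * b + b * c + 4 - b * b))) as [y Ey].
  { rewrite Ert, Ebs. ring. }
  (* Here [e] is (abc - rst)/2, so that d = a + b + c + e. *)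
  destruct (even_diff_of_squares (a * b * c) (r * s * t)
    (- (2 * (a * b * c * (a + b + c)) + 8 * (a * b + b * c + a * c) + 32))%Z)
    as [e Ee].
  { replace (r * s * t * (r * s * t))%Z
      with (r * s * (r * s) * (t * t))%Z by ring.
    rewrite Ers, Et. ring. }
  exists (a + b + c + e)%Z, x, y.
  (* With d the witness just chosen, 4(cd + 4) is a square; together with [Hc5] this gives d >= 0
     below. *)
  assert (Ez : ((c * r - s * t) * (c * r - s * t)
                = 4 * (c * (a + b + c + e) + 4))%Z).
  { transitivity (c * c * (r * r) + s * t * (s * t) - 2 * c * (r * s * t))%Z;
      [ring|].
    rewrite Er, Est. replace (r * s * t)%Z with (a * b * c - 2 * e)%Z by lia.
    ring. }
  assert (Exx : (4 * (x * x) = 4 * (a * (a + b + c + e) + 4))%Z).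
  { transitivity ((r * s - a * t) * (r * s - a * t))%Z; [rewrite Ex; ring|].
    transitivity (r * s * (r * s) + a * t * (a * t) - 2 * a * (r * s * t))%Z;
      [ring|].
    rewrite Ers, Eat. replace (r * s * t)%Z with (a * b * c - 2 * e)%Z by lia.
    ring. }
  assert (Eyy : (4 * (y * y) = 4 * (b * (a + b + c + e) + 4))%Z).
  { transitivity ((r * t - b * s) * (r * t - b * s))%Z; [rewrite Ey; ring|].
    transitivity (r * t * (r * t) + b * s * (b * s) - 2 * b * (r * s * t))%Z;
      [ring|].
    rewrite Ert, Ebs. replace (r * s * t)%Z with (a * b * c - 2 * e)%Z by lia.
    ring. }
  assert (Hx : (a * t < r * s)%Z).
  { apply Z.square_lt_simpl_nonneg; [nia|]. rewrite Eat, Ers. nia. }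
  assert (Hy : (b * s < r * t)%Z).
  { apply Z.square_lt_simpl_nonneg; [nia|]. rewrite Ebs, Ert. nia. }
  repeat split; try lia.
  - pose proof (Z.square_nonneg (c * r - s * t)). nia.
  (* With 2x = rs - at and 2y = rt - bs the terms in t cancel, leaving s(r^2 - ab) = 4s. *)
  - assert (2 * (2 * s) = r * (2 * x) + a * (2 * y))%Z; [|lia].
    rewrite <- Ex, <- Ey.
    transitivity (s * (r * r - a * b))%Z; [rewrite Er; ring|ring].
  - assert (2 * (2 * t) = r * (2 * y) + b * (2 * x))%Z; [|lia].
    rewrite <- Ex, <- Ey.
    transitivity (t * (r * r - a * b))%Z; [rewrite Er; ring|ring].
Qed.

(* The equality a = 3, b = 4, d = 15, r = 4, x = 7, y = 8 shows that this is
   sharp; it comes from the degenerate triple {3, 4, 224}, where r + s = t. *)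
Lemma consecutive_roots_bound (a b d r x : Z) :
  (0 < a)%Z -> (a < b)%Z -> (0 < d)%Z -> (0 < r)%Z -> (0 < x)%Z ->
  (r * r = a * b + 4)%Z -> (x * x = a * d + 4)%Z ->
  ((x + 1) * (x + 1) = b * d + 4)%Z ->
  (r <= b * x - a * (x + 1))%Z.
Proof.
  intros Ha Hab Hd Hr Hx Er Ex Ey.
  (* Subtract the two square equations; b - a >= 1 then bounds d. *)
  assert (Hd1 : ((b - a) * d = 2 * x + 1)%Z) by lia.
  assert (Hd2 : (d <= 2 * x + 1)%Z) by nia.
  assert (Had : (a * d = x * x - 4)%Z) by lia.
  assert (Hbd : (b * d = x * x + 2 * x - 3)%Z) by lia.
  assert (Hl : ((b * x - a * (x + 1)) * d = x * x + x + 4)%Z).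
  { transitivity (b * d * x - a * d * (x + 1))%Z; [ring|].
    rewrite Had, Hbd. ring. }
  assert (Hrd : (r * d * (r * d)
                 = (x * x - 4) * (x * x + 2 * x - 3) + 4 * (d * d))%Z).
  { transitivity (r * r * (d * d))%Z; [ring|].
    rewrite Er, <- Had, <- Hbd. ring. }
  assert (Hdd : (d * d <= (2 * x + 1) * (2 * x + 1))%Z) by nia.
  (* After multiplying by d and squaring, the gap between the two sides is 4((2x + 1)^2 - d^2). *)
  apply Z.mul_le_mono_pos_r with d; [assumption|]. rewrite Hl.
  apply Z.square_le_simpl_nonneg; [lia|]. rewrite Hrd.
  assert (((x * x + x + 4) * (x * x + x + 4)
           = (x * x - 4) * (x * x + 2 * x - 3)
             + 4 * ((2 * x + 1) * (2 * x + 1)))%Z) by ring.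
  lia.
Qed.

Lemma D4_regular_of_triangle (a b c r s t : Z) :
  (0 < a)%Z -> (a < b)%Z -> (b < c)%Z ->
  (0 < r)%Z -> (0 < s)%Z -> (0 < t)%Z ->
  (r * r = a * b + 4)%Z -> (s * s = a * c + 4)%Z -> (t * t = b * c + 4)%Z ->
  (t < r + s)%Z ->
  (c = a + b + 2 * r)%Z.
Proof.
  intros Ha Hab Hbc Hr Hs Ht Er Es Et Htri.
  destruct (D4_extension a b c r s t Ha Hab Hbc Hr Hs Ht Er Es Et)
    as (d & x & y & Hd & Hx & Hy & Ex & Ey & Exs & Eyt).
  destruct (Z.eq_dec d 0) as [->|Hd0].
  - assert (x = 2)%Z by nia. assert (y = 2)%Z by nia. subst x y.
    (* Subtract r^2 = ab + 4 from (r + a)^2 = ac + 4 and cancel a. *)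
    assert (Hsr : s = (r + a)%Z) by lia. subst s. nia.
  - exfalso.
    assert (Hxy : (x < y)%Z) by (apply Z.square_lt_simpl_nonneg; nia).
    destruct (Z.eq_dec y (x + 1)) as [->|Hxy1].
    + assert (r <= b * x - a * (x + 1))%Z
        by (apply (consecutive_roots_bound a b d r x); lia).
      lia.
    + assert (Hlt : (a * y < b * x)%Z).
      { apply Z.square_lt_simpl_nonneg; [nia|].
        replace (a * y * (a * y))%Z with (a * a * (y * y))%Z by ring.
        replace (b * x * (b * x))%Z with (b * b * (x * x))%Z by ring.
        rewrite Ex, Ey.
        (* The difference of the squares is abd(b - a) + 4(b^2 - a^2). *)
        assert (0 < a * b * d * (b - a))%Z by (repeat apply Z.mul_pos_pos; lia).
        nia. }
      nia.
Qed.

(** * Real square roots, angles and distances *)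

Lemma sqrt_perfect_square (m : Z) :
  (0 < m)%Z -> perfect_square m ->
  exists k : Z, (0 < k)%Z /\ (k * k = m)%Z /\ sqrt (IZR m) = IZR k.
Proof.
  intros Hm [k ->]. exists (Z.abs k). repeat split; [nia|nia|].
  rewrite mult_IZR, abs_IZR. exact (sqrt_Rsqr_abs (IZR k)).
Qed.

(* Stdlib's [acos] is [PI] below [-1] and [0] above [1], so [u] needs no bound. *)
Lemma acos_compare (u : R) :
  (acos u < PI / 2 <-> 0 < u) /\ (acos u = PI / 2 <-> u = 0) /\
  (acos u > PI / 2 <-> u < 0).
Proof.
  assert (Hpos : 0 < u -> acos u < PI / 2).
  { intros H. pose proof PI_RGT_0. pose proof (acos_bound u) as Hb.
    destruct (Rle_dec u 1) as [H1|H1].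
    - apply cos_decreasing_0; try lra; rewrite cos_PI2, cos_acos; lra.
    - unfold acos. destruct (Rle_dec u (-1)); [lra|].
      destruct (Rle_dec 1 u); lra. }
  assert (Hneg : u < 0 -> acos u > PI / 2).
  { intros H. pose proof PI_RGT_0. pose proof (acos_bound u) as Hb.
    destruct (Rle_dec (-1) u) as [H1|H1].
    - apply cos_decreasing_0; try lra; rewrite cos_PI2, cos_acos; lra.
    - unfold acos. destruct (Rle_dec u (-1)); lra. }
  assert (Hzero : u = 0 -> acos u = PI / 2) by (intros ->; exact acos_0).
  (* The hypotheses of the three implications are exhaustive and their conclusions exclusive, so the
     converses follow. *)
  destruct (Rtotal_order u 0) as [H|[H|H]];
    [specialize (Hneg H)|specialize (Hzero H)|specialize (Hpos H)];
    repeat split; intros; lra.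
Qed.

Lemma dist_sym (P Q : point) : dist P Q = dist Q P.
Proof. apply distance_symm. Qed.

Lemma dist_sqr (P Q : point) :
  dist P Q * dist P Q = (fst P - fst Q) ^ 2 + (snd P - snd Q) ^ 2.
Proof.
  unfold dist, dist_euc. rewrite sqrt_sqrt; [unfold Rsqr; ring|].
  apply Rplus_le_le_0_compat; apply Rle_0_sqr.
Qed.

(** By the law of cosines, [k] is the argument of [acos] in [angle] times a positive factor. *)
Lemma angle_compare (P V Q : point) :
  0 < dist P V -> 0 < dist V Q ->
  let k := dist P V ^ 2 + dist V Q ^ 2 - dist P Q ^ 2 in
  (angle P V Q < PI / 2 <-> 0 < k) /\ (angle P V Q = PI / 2 <-> k = 0) /\
  (angle P V Q > PI / 2 <-> k < 0).
Proof.
  intros H1 H2 k. unfold angle.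
  set (u := (_ / _)).
  assert (Hp : 0 < 2 * (dist P V * dist V Q)) by nra.
  assert (Hk : k = u * (2 * (dist P V * dist V Q))).
  { unfold k, u. rewrite (dist_sym Q V).
    replace (dist P V ^ 2 + dist V Q ^ 2 - dist P Q ^ 2)
      with (dist P V * dist P V + dist V Q * dist V Q - dist P Q * dist P Q)
      by ring.
    rewrite !dist_sqr. field. lra. }
  destruct (acos_compare u) as (C1 & C2 & C3).
  rewrite C1, C2, C3, Hk. repeat split; intros; nra.
Qed.

Lemma dist_triangle (A B C : point) : dist A C <= dist A B + dist B C.
Proof. apply triangle. Qed.

(** Equality in the triangle inequality makes AB and BC parallel. The contrapositive yields r + s >
    t. *)
Lemma dist_add_collinear (A B C : point) :
  0 < dist A B -> dist C A = dist A B + dist B C -> collinear A B C.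
Proof.
  intros H0 H.
  pose proof (dist_sqr A B) as E1. pose proof (dist_sqr B C) as E2.
  pose proof (dist_sqr C A) as E3. rewrite H in E3.
  set (p := dist A B) in *. set (q := dist B C) in *.
  destruct A as [a1 a2], B as [b1 b2], C as [c1 c2]; cbn [fst snd] in *.
  (* Equality in Cauchy-Schwarz for the vectors AB and BC. *)
  assert (Hdot : (b1 - a1) * (c1 - b1) + (b2 - a2) * (c2 - b2) = p * q) by nra.
  (* Lagrange's identity: the squared cross product is |AB|^2 |BC|^2 minus the squared dot
     product. *)
  assert (Hcross : ((b1 - a1) * (c2 - b2) - (b2 - a2) * (c1 - b1)) ^ 2 = 0).
  { transitivity (((a1 - b1) ^ 2 + (a2 - b2) ^ 2)
                  * ((b1 - c1) ^ 2 + (b2 - c2) ^ 2)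
                  - ((b1 - a1) * (c1 - b1) + (b2 - a2) * (c2 - b2)) ^ 2);
      [ring|].
    rewrite <- E1, <- E2, Hdot. ring. }
  assert (Hcr : (b1 - a1) * (c2 - b2) - (b2 - a2) * (c1 - b1) = 0) by nra.
  (* The line through A with normal perpendicular to AB; the normal is nonzero because A and B
     differ. *)
  exists (b2 - a2), (a1 - b1), ((b2 - a2) * a1 + (a1 - b1) * a2).
  cbn [fst snd]. repeat split; [|ring|lra].
  destruct (Req_dec (b2 - a2) 0) as [Ha|Ha]; [right|left; exact Ha].
  intros Hb. nra.
Qed.

Theorem corollary4p3 :
  forall (a b c : Z) (r s t : R),
    D4_triple a b c ->
    (a < b < c)%Z ->
    r = sqrt (IZR a * IZR b + 4) ->
    s = sqrt (IZR a * IZR c + 4) ->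
    t = sqrt (IZR b * IZR c + 4) ->
    (exists A B C : point, triangle_with_sides A B C r s t) ->
    r ^ 2 + s ^ 2 - t ^ 2
      = r ^ 2 - (IZR b - IZR a) * (2 * r + IZR a + IZR b) /\
    (forall A B C : point, triangle_with_sides A B C r s t ->
       exactly_one (acute_triangle A B C) (right_triangle A B C)
                   (obtuse_triangle A B C) /\
       (acute_triangle A B C <->
          r ^ 2 > (IZR b - IZR a) * (2 * r + IZR a + IZR b)) /\
       (right_triangle A B C <->
          r ^ 2 = (IZR b - IZR a) * (2 * r + IZR a + IZR b)) /\
       (obtuse_triangle A B C <->
          r ^ 2 < (IZR b - IZR a) * (2 * r + IZR a + IZR b))).
Proof.
  intros a b c r s t ((Ha & Hb & Hc) & _ & Sr & Ss & St) [Hab Hbc] Hr Hs Ht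
    (A0 & B0 & C0 & Hncol & H1 & H2 & H3).
  destruct (sqrt_perfect_square (a * b + 4) ltac:(nia) Sr) as (r' & Hr0 & Er & Qr).
  destruct (sqrt_perfect_square (a * c + 4) ltac:(nia) Ss) as (s' & Hs0 & Es & Qs).
  destruct (sqrt_perfect_square (b * c + 4) ltac:(nia) St) as (t' & Ht0 & Et & Qt).
  rewrite plus_IZR, mult_IZR in Qr, Qs, Qt.
  rewrite Qr in Hr. rewrite Qs in Hs. rewrite Qt in Ht.
  clear Qr Qs Qt Sr Ss St.
  assert (Pr : 0 < r) by (rewrite Hr; now apply IZR_lt).
  assert (Htri : (t' < r' + s')%Z).
  { apply lt_IZR. rewrite plus_IZR, <- Hr, <- Hs, <- Ht.
    (* If t >= r + s, the triangle inequality forces equality, and the vertices are collinear. *)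
    destruct (Rlt_or_le t (r + s)) as [|Hge]; [assumption|exfalso].
    apply Hncol, dist_add_collinear; [lra|].
    pose proof (dist_triangle A0 B0 C0). rewrite (dist_sym A0 C0) in *. lra. }
  assert (Hreg : (c = a + b + 2 * r')%Z)
    by (apply (D4_regular_of_triangle a b c r' s' t'); assumption).
  assert (Hrs : (r' < s')%Z) by (apply Z.square_lt_simpl_nonneg; nia).
  assert (Hst : (s' < t')%Z) by (apply Z.square_lt_simpl_nonneg; nia).
  apply IZR_lt in Hrs, Hst. rewrite <- Hr, <- Hs in Hrs.
  rewrite <- Hs, <- Ht in Hst.
  assert (Hid : r ^ 2 + s ^ 2 - t ^ 2
                = r ^ 2 - (IZR b - IZR a) * (2 * r + IZR a + IZR b)).
  { rewrite Hr, Hs, Ht.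
    (* t^2 - s^2 = (b - a)c, and [Hreg] gives c = a + b + 2r. *)
    apply (f_equal IZR) in Es, Et, Hreg.
    rewrite plus_IZR, !mult_IZR in Es, Et. rewrite !plus_IZR, mult_IZR in Hreg.
    replace (2 * IZR r' + IZR a + IZR b) with (IZR c) by lra. nra. }
  split; [exact Hid|].
  intros A B C (_ & D1 & D2 & D3).
  unfold exactly_one, acute_triangle, right_triangle, obtuse_triangle.
  destruct (angle_compare B A C) as (A1 & A2 & A3);
    [rewrite dist_sym; lra|rewrite dist_sym; lra|].
  destruct (angle_compare C B A) as (B1 & B2 & B3);
    [rewrite dist_sym; lra|rewrite dist_sym; lra|].
  destruct (angle_compare A C B) as (C1 & C2 & C3);
    [rewrite dist_sym; lra|rewrite dist_sym; lra|].
  rewrite A1, A2, A3, B1, B2, B3, C1, C2, C3.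
  rewrite (dist_sym B A), (dist_sym A C), (dist_sym C B), D1, D2, D3.
  clear A1 A2 A3 B1 B2 B3 C1 C2 C3.
  (* As r < s < t, the law-of-cosines quantities at A and C are positive; only the angle at B,
     opposite t, decides. *)
  assert (Hsr2 : r ^ 2 < s ^ 2) by nra.
  assert (Hts2 : s ^ 2 < t ^ 2) by nra.
  assert (Hr2 : 0 < r ^ 2) by nra.
  replace (s ^ 2 + r ^ 2 - t ^ 2)
    with (r ^ 2 - (IZR b - IZR a) * (2 * r + IZR a + IZR b)) by lra.
  (* What remains is trichotomy between r^2 and this expression. *)
  generalize dependent ((IZR b - IZR a) * (2 * r + IZR a + IZR b)).
  intros m _.
  destruct (Rtotal_order (r ^ 2) m) as [H|[H|H]]; intuition lra.
Qed.
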